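(* Let $n,m\ge1$, $\mathcal X\subseteq\mathbb Z^p\times\mathbb R^{n-p}$ with $0\le p\le n$, and for every $i\in[m]$ let $\mathcal U_i\subseteq\mathbb R^{L_i}$ be a set, $\overline u^i\in\mathcal U_i$, and $f_i:\mathbb R^n\times\mathcal U_i\to\mathbb R$ an arbitrary function. If $\Gamma\in[m]$, then the $\Gamma$-counterpart $$\inf_{x\in\mathcal X}\ \sup_{\mathcal S\subseteq[m]:|\mathcal S|\le\Gamma}\Big\{\sum_{i\in\mathcal S}\sup_{u^i\in\mathcal U_i}f_i(x,u^i)+\sum_{i\in[m]\setminus\mathcal S}f_i(x,\overline u^i)\Big\}$$ is equivalent to $$\inf_{k\in[m]_0}\Big\{\inf_{x\in\mathcal X}\Big\{\Gamma\theta^k(x)+\sum_{i\in[m]}\big(f_i(x,\overline u^i)+\sup\{0,\theta^i(x)-\theta^k(x)\}\big)\Big\}\Big\},$$ where $\theta^k(x):=\sup_{u^k\in\mathcal U_k}f_k(x,u^k)-f_k(x,\overline u^k)$ for $k\in[m]$ and $\theta^0(x):=0$.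
   Context: Notation: $[m]:=\{1,\dots,m\}$, $[m]_0:=\{0,1,\dots,m\}$. If $\theta^k(x)=+\infty$, the objective value of the $k$-th inner program at $x$ is read as $+\infty$. Two minimization programs in $x$ (possibly with further auxiliary variables or indices) are called equivalent if they have the same optimal value in $[-\infty,\infty]$ and, whenever this value is finite, a point $x\in\mathcal X$ attains it in one program (for a suitable choice of the auxiliary variables or indices) if and only if it does so in the other. *)

(* Defs.v *)
From mathcomp Require Import all_boot all_order all_algebra.
From mathcomp Require Import all_classical all_reals all_analysis.
Set Implicit Arguments.
Unset Strict Implicit.
Unset Printing Implicit Defensive.
Import Order.TTheory GRing.Theory Num.Theory.
Local Open Scope ring_scope.
Local Open Scope classical_set_scope.
Local Open Scope ereal_scope.

(* Minimization programs in x : T, possibly nested under further indices: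
   [Minimize X g] is inf_{x in X} g x and [InfIndex P] is inf_{k : K} P k. *)
Inductive program (R : realType) (T : Type) : Type :=
| Minimize (X : set T) (g : T -> \bar R)
| InfIndex (K : Type) (P : K -> program R T).
Arguments InfIndex {R T K} P.

Fixpoint opt_value (R : realType) (T : Type) (P : program R T) : \bar R :=
  match P with
  | Minimize X g => ereal_inf [set g x | x in X]
  | InfIndex K P => ereal_inf [set opt_value (P k) | k in @setT K]
  end.

(* x is feasible and has objective value v for a suitable choice of indices. *)
Fixpoint takes_value (R : realType) (T : Type) (P : program R T)
    (x : T) (v : \bar R) : Prop :=
  match P with
  | Minimize X g => X x /\ g x = v
  | InfIndex K P => exists k : K, takes_value (P k) x v
  end.

Definition attains_opt (R : realType) (T : Type) (P : program R T) (x : T) :=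
  takes_value P x (opt_value P).

Definition equivalent_programs (R : realType) (T : Type)
    (P Q : program R T) : Prop :=
  opt_value P = opt_value Q /\
  (opt_value P \is a fin_num ->
   forall x, attains_opt P x <-> attains_opt Q x).

(* Z^p x R^(n-p) *)
Definition mixed_integer (R : realType) (n p : nat) : set 'rV[R]_n :=
  [set x | forall j : 'I_n, (j < p)%N -> x ord0 j \is a Num.int].
Arguments mixed_integer : clear implicits.

Section Counterpart.
Context (R : realType) (n m : nat) (L : 'I_m -> nat).
Unset Implicit Arguments.
Variables (X : set 'rV[R]_n) (U : forall i, set 'rV[R]_(L i)).
(* Only the values of [f i x] on [U i] are ever used. *)
Variables (ubar : forall i, 'rV[R]_(L i))
  (f : forall i, 'rV[R]_n -> 'rV[R]_(L i) -> R) (Gamma : nat).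
Set Implicit Arguments.

Definition worst_case (i : 'I_m) (x : 'rV[R]_n) : \bar R :=
  ereal_sup [set (f i x u)%:E | u in U i].

Definition nominal (i : 'I_m) (x : 'rV[R]_n) : \bar R := (f i x (ubar i))%:E.

Definition Gamma_objective (x : 'rV[R]_n) : \bar R :=
  ereal_sup [set \sum_(i in S) worst_case i x
                 + \sum_(i in ~: S) nominal i x
            | S in [set S : {set 'I_m} | (#|S| <= Gamma)%N]].

Definition Gamma_counterpart : program R 'rV[R]_n := Minimize X Gamma_objective.

(* 'I_m.+1 is {0, ..., m}; the index i : 'I_m of f and U appears in it as
   lift ord0 i, so that theta (lift ord0 i) is the deviation of f i. *)
Definition theta (k : 'I_m.+1) (x : 'rV[R]_n) : \bar R :=
  if unlift ord0 k is Some i then worst_case i x - nominal i x else 0.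

(* The first branch is a convention: +oo - +oo is meaningless in the sum. *)
Definition theta_objective (k : 'I_m.+1) (x : 'rV[R]_n) : \bar R :=
  if theta k x == +oo then +oo
  else Gamma%:R%:E * theta k x
       + \sum_(i < m)
           (nominal i x + maxe 0 (theta (lift ord0 i) x - theta k x)).

Definition theta_reformulation : program R 'rV[R]_n :=
  InfIndex (fun k : 'I_m.+1 => Minimize X (theta_objective k)).

End Counterpart.

(* Main.v *)
Require Import Defs.
From mathcomp Require Import all_boot all_order all_algebra.
From mathcomp Require Import all_classical all_reals all_analysis.
Set Implicit Arguments.
Unset Strict Implicit.
Unset Printing Implicit Defensive.
Import Order.TTheory GRing.Theory Num.Theory.
Local Open Scope ring_scope.
Local Open Scope classical_set_scope.

(** Both programs have the same objective once the index [k] is minimized out,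
    pointwise in [x].  Fix [x] and write [t i >= 0] for the deviation of [f i].

    If some [t i] is [+oo], both objectives are [+oo]: on the left because
    [{i}] is an admissible set, on the right because either [theta k x] is
    [+oo] or the [i]-th summand is.

    If all the [t i] are real, then, up to the sum of the nominal values, the
    inner supremum is the maximum of [\sum_(i in S) t i] over [#|S| <= Gamma],
    and the other side is the Lagrangian dual of this selection problem, with
    the multiplier [c] of the cardinality constraint restricted to 0 and the
    [t k].  Weak duality ([sum_le_dual]) holds for every [c >= 0].  An optimal
    [S] comes with a multiplier of this form satisfying complementary slackness
    ([exists_complementary_slackness]), and then both values coincide
    ([sum_eq_dual]).

    So the left objective is a lower bound of all the [k]-th objectives, and is
    reached by one of them at each [x]; this makes the programs equivalent
    ([equivalent_Minimize_InfIndex]). *)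

(** * Programs whose index can be minimized out *)

(** The two optimal values agree because infima commute.  If [h k x] reaches
    the common value, so does [g x], which lies between that value and [h k x];
    conversely, if [g x] reaches it, so does the [h k x] equal to [g x]. *)
Lemma equivalent_Minimize_InfIndex (R : realType) (T K : Type) (X : set T)
    (g : T -> \bar R) (h : K -> T -> \bar R) :
  (forall k x, X x -> (g x <= h k x)%E) ->
  (forall x, X x -> exists k, h k x = g x) ->
  equivalent_programs (Minimize X g) (InfIndex (fun k => Minimize X (h k))).
Proof.
move=> gh hg.
have opt_eq : opt_value (Minimize X g)
              = opt_value (InfIndex (fun k => Minimize X (h k))).
  apply/eqP; rewrite eq_le; apply/andP; split.
    apply: le_ereal_inf_tmp => _ [k _ <-].
    apply: le_ereal_inf_tmp => _ [x Xx <-].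
    by apply: le_trans (gh k x Xx); apply: ereal_inf_lbound; exists x.
  apply: le_ereal_inf_tmp => _ [x Xx <-]; have [k <-] := hg x Xx.
  apply: (@le_trans _ _ (opt_value (Minimize X (h k)))).
    by apply: ereal_inf_lbound; exists k.
  by apply: ereal_inf_lbound; exists x.
split=> // _ x; rewrite /attains_opt -opt_eq; split=> /=.
  by move=> [Xx <-]; have [k <-] := hg x Xx; exists k.
move=> [k [Xx hE]]; split=> //; apply/eqP; rewrite eq_le.
by rewrite -{1}hE gh //=; apply: ereal_inf_lbound; exists x.
Qed.

(** * Selecting at most G terms of largest sum, and its dual *)

Section Selection.
Context (R : realDomainType) (I : finType) (t : I -> R) (G : nat).
Implicit Types (S : {set I}) (c : R).

(** Weak duality: [t i <= c + max 0 (t i - c)], and the [#|S|] copies of [c]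
    amount to at most [G] of them because [c] is nonnegative. *)
Lemma sum_le_dual S c : 0 <= c -> (#|S| <= G)%N ->
  \sum_(i in S) t i <= G%:R * c + \sum_i Num.max 0 (t i - c).
Proof.
move=> c0 SG.
apply: (@le_trans _ _ (\sum_(i in S) (c + Num.max 0 (t i - c)))).
  by apply: ler_sum => i _; rewrite -lerBlDl le_max lexx orbT.
rewrite big_split /= sumr_const -[c *+ _]mulr_natl lerD//.
  by rewrite ler_wpM2r ?ler_nat.
rewrite [leRHS](bigID (mem S)) /= lerDl.
by apply: sumr_ge0 => i _; rewrite le_max lexx.
Qed.

(** Under complementary slackness the estimates of weak duality are tight:
    [max 0 (t i - c)] is [t i - c] on [S] and 0 outside, and the copies of [c]
    for the unused part of the budget [G] cost nothing. *)
Lemma sum_eq_dual S c :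
  {in S, forall i, c <= t i} -> {in ~: S, forall i, t i <= c} ->
  #|S|%:R * c = G%:R * c ->
  \sum_(i in S) t i = G%:R * c + \sum_i Num.max 0 (t i - c).
Proof.
move=> cS cNS <-; rewrite [X in _ + X](bigID (mem S)) /=.
rewrite [X in _ + (_ + X)]big1 ?addr0; last first.
  move=> i iS; apply/max_idPl; rewrite subr_le0; apply: cNS.
  by rewrite inE.
rewrite mulr_natl -sumr_const -big_split /=; apply: eq_bigr => i iS.
by rewrite (max_idPr _) ?subr_ge0 ?cS // addrC subrK.
Qed.

(** Take [S] of maximal sum.  If the cardinality constraint is slack, adding an
    index cannot help, so that the terms outside [S] are at most 0 and the
    multiplier is 0.  If it is tight, exchanging the smallest term of [S] with
    one outside cannot help, so that this smallest term is a multiplier. *)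
Lemma exists_complementary_slackness : (0 < G)%N -> (forall i, 0 <= t i) ->
  exists S (o : option I), let c := oapp t 0 o in
    [/\ (#|S| <= G)%N, {in S, forall i, c <= t i},
        {in ~: S, forall i, t i <= c} & #|S|%:R * c = G%:R * c].
Proof.
move=> G0 t0.
have card0 : (#|finset.set0 : {set I}| <= G)%N by rewrite cards0.
case: (@arg_maxP _ _ _ finset.set0 (fun S : {set I} => #|S| <= G)%N
         (fun S : {set I} => \sum_(i in S) t i) card0) => S SG Smax.
have [SltG | GleS] := ltnP #|S| G.
  exists S, None; split=> //= [i|]; last by rewrite !mulr0.
  rewrite inE => iS; have := Smax (i |: S)%SET.
  by rewrite cardsU1 iS add1n => /(_ SltG); rewrite /= big_setU1 //= gerDr.
have cardS : #|S| = G by apply/eqP; rewrite eqn_leq SG.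
have /card_gt0P[k0 k0S] : (0 < #|S|)%N by rewrite cardS.
case: (@arg_minP _ _ _ k0 (mem S) t k0S) => k kS kmin.
exists S, (Some k); split=> //= [i|]; last by rewrite cardS.
rewrite inE => iS.
have iSk : i \notin (S :\ k)%SET by rewrite !inE (negbTE iS) andbF.
have := Smax (i |: (S :\ k))%SET.
rewrite cardsU1 iSk add1n (_ : #|S :\ k|.+1 = #|S|); last first.
  by rewrite (cardsD1 k S) (kS : k \in S).
move=> /(_ SG); rewrite /= big_setU1 //= (big_setD1 k kS) /=.
by rewrite lerD2r.
Qed.

End Selection.

(** * The objectives at a fixed point *)

Section Pointwise.
Context (R : realType) (n m : nat) (L : 'I_m -> nat).
Unset Implicit Arguments.
Variables (U : forall i, set 'rV[R]_(L i)) (ubar : forall i, 'rV[R]_(L i))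
  (f : forall i, 'rV[R]_n -> 'rV[R]_(L i) -> R) (Gamma : nat) (x : 'rV[R]_n).
Set Implicit Arguments.
Hypotheses (ubarU : forall i, U i (ubar i)) (Gamma_gt0 : (0 < Gamma)%N).

Let worst i := worst_case U f i x.
Let nom i := f i x (ubar i).

Lemma nominal_le_worst i : ((nom i)%:E <= worst i)%E.
Proof. by apply: ereal_sup_ubound; exists (ubar i). Qed.

Lemma worst_neqNy i : worst i != -oo%E.
Proof. by rewrite gt_eqF // (lt_le_trans (ltNyr _) (nominal_le_worst i)). Qed.

Lemma theta_lift i :
  theta U ubar f (lift ord0 i) x = (worst i - (nom i)%:E)%E.
Proof. by rewrite /theta liftK. Qed.

Lemma theta_ge0 k : (0 <= theta U ubar f k x)%E.
Proof.
rewrite /theta; case: unliftP => [i _|//].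
by rewrite sube_ge0 // nominal_le_worst.
Qed.

Lemma Gamma_objective_pinfty i : worst i = +oo%E ->
  Gamma_objective U ubar f Gamma x = +oo%E.
Proof.
move=> wi; apply/eqP; rewrite -leye_eq.
apply: le_trans (ereal_sup_ubound _); last first.
  by exists [set i]%SET => //=; rewrite cards1.
rewrite big_set1 -/(worst i) wi addye // gt_eqF //.
by rewrite sumEFin ltNyr.
Qed.

Lemma theta_objective_pinfty k i : worst i = +oo%E ->
  theta_objective U ubar f Gamma k x = +oo%E.
Proof.
move=> wi; rewrite /theta_objective; case: eqP => // /eqP thk.
have /fineK <- : theta U ubar f k x \is a fin_num.
  by rewrite ge0_fin_numE ?theta_ge0 // ltey.
suff -> : (\sum_(j < m) (nominal ubar f j x
    + maxe 0 (theta U ubar f (lift ord0 j) x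
              - (fine (theta U ubar f k x))%:E)) = +oo)%E.
  by rewrite addey // -EFinM ltNye.
(* No summand is -oo: the nominal value is real and the max nonnegative. *)
apply/eqP; rewrite esum_eqy => [|j _]; last first.
  by rewrite adde_eq_ninfty negb_or /= gt_eqF // lt_max ltNyr.
apply/existsP; exists i.
by rewrite /= theta_lift wi addye // (max_idPr _) ?leey // addey.
Qed.

(** Real deviations: the nominal values come out of both objectives, which
    leaves the selection problem and its dual. *)
Section FiniteDeviations.
Hypothesis worst_fin : forall i, worst i \is a fin_num.

Let dev i := fine (worst i) - nom i.

Lemma dev_ge0 i : 0 <= dev i.
Proof. by rewrite subr_ge0 -lee_fin fineK // nominal_le_worst. Qed.

Lemma Gamma_objective_fin : Gamma_objective U ubar f Gamma x =
  ereal_sup [set (\sum_i nom i + \sum_(i in S) dev i)%:E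
            | S in [set S : {set 'I_m} | (#|S| <= Gamma)%N]].
Proof.
congr ereal_sup; apply: eq_imagel => S _.
under eq_bigr do rewrite -/(worst _) -(fineK (worst_fin _)).
rewrite !sumEFin -EFinD; congr EFin.
rewrite [X in _ = X + _](bigID (mem S)) /= addrAC -big_split /=; congr (_ + _).
  by apply: eq_bigr => i _; rewrite addrC subrK.
by apply: eq_bigl => i; rewrite inE.
Qed.

Lemma theta_objective_fin k (c : R) : theta U ubar f k x = c%:E ->
  theta_objective U ubar f Gamma k x =
  (\sum_i nom i + (Gamma%:R * c + \sum_i Num.max 0 (dev i - c)))%:E.
Proof.
move=> thk; rewrite /theta_objective thk /=.
under eq_bigr do
  rewrite theta_lift -(fineK (worst_fin _)) -!EFinB -EFin_max -EFinD.
by rewrite sumEFin -EFinM -EFinD big_split /= addrCA.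
Qed.

Lemma theta_lift_fin i : theta U ubar f (lift ord0 i) x = (dev i)%:E.
Proof. by rewrite theta_lift -(fineK (worst_fin _)). Qed.

Lemma theta_ord0 : theta U ubar f ord0 x = 0%E.
Proof. by rewrite /theta unlift_none. Qed.

Lemma Gamma_objective_le_fin k :
  (Gamma_objective U ubar f Gamma x <= theta_objective U ubar f Gamma k x)%E.
Proof.
have [c thk c0] : exists2 c : R, theta U ubar f k x = c%:E & 0 <= c.
  case: (unliftP ord0 k) => [i -> | ->].
    by exists (dev i); [exact: theta_lift_fin | exact: dev_ge0].
  by exists 0; first exact: theta_ord0.
rewrite Gamma_objective_fin (theta_objective_fin thk).
by apply: ge_ereal_sup => _ [S /= SG <-]; rewrite lee_fin lerD2l sum_le_dual.
Qed.

Lemma exists_theta_objective_eq_fin : exists k,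
  theta_objective U ubar f Gamma k x = Gamma_objective U ubar f Gamma x.
Proof.
have [S [j [SG jS jNS slack]]] :=
  exists_complementary_slackness Gamma_gt0 dev_ge0.
(* The multiplier 0 is the value of theta at the index 0. *)
pose k := oapp (lift ord0) ord0 j.
have thk : theta U ubar f k x = (oapp dev 0 j)%:E.
  rewrite /k; case: (j) => [i|] /=; first exact: theta_lift_fin.
  exact: theta_ord0.
exists k; apply/eqP; rewrite eq_le Gamma_objective_le_fin andbT.
rewrite (theta_objective_fin thk) -(sum_eq_dual jS jNS slack).
rewrite Gamma_objective_fin.
by apply: ereal_sup_ubound; exists S.
Qed.

End FiniteDeviations.

Lemma worst_finVpinfty :
  (forall i, worst i \is a fin_num) \/ (exists i, worst i = +oo%E).
Proof.
case: (pselect (exists i, worst i = +oo%E)) => [|nw]; [by right | left=> i].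
rewrite fin_numE worst_neqNy; apply/eqP => wi.
by apply: nw; exists i.
Qed.

Lemma Gamma_objective_le k :
  (Gamma_objective U ubar f Gamma x <= theta_objective U ubar f Gamma k x)%E.
Proof.
case: worst_finVpinfty => [wfin|[i wi]]; first exact: Gamma_objective_le_fin.
by rewrite (theta_objective_pinfty _ wi) leey.
Qed.

Lemma exists_theta_objective_eq : exists k,
  theta_objective U ubar f Gamma k x = Gamma_objective U ubar f Gamma x.
Proof.
case: worst_finVpinfty => [wfin|[i wi]].
  exact: exists_theta_objective_eq_fin.
exists ord0.
by rewrite (theta_objective_pinfty _ wi) (Gamma_objective_pinfty wi).
Qed.

End Pointwise.

Theorem lemma3p2 (R : realType) (n m p : nat)
    (hn : (1 <= n)%N) (hm : (1 <= m)%N) (hp : (p <= n)%N)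
    (X : set 'rV[R]_n) (hX : X `<=` mixed_integer R n p)
    (L : 'I_m -> nat) (U : forall i : 'I_m, set 'rV[R]_(L i))
    (ubar : forall i : 'I_m, 'rV[R]_(L i))
    (hubar : forall i : 'I_m, U i (ubar i))
    (f : forall i : 'I_m, 'rV[R]_n -> 'rV[R]_(L i) -> R)
    (Gamma : nat) (hGamma : (1 <= Gamma <= m)%N) :
  equivalent_programs (Gamma_counterpart X U ubar f Gamma)
                      (theta_reformulation X U ubar f Gamma).
Proof.
have Gamma_gt0 : (0 < Gamma)%N by case/andP: hGamma.
apply: equivalent_Minimize_InfIndex => [k x _|x _].
  exact: Gamma_objective_le.
exact: exists_theta_objective_eq.
Qed.
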